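(* For each of the following sets $R\subseteq\{0,1,2,3\}^2$ we have $(123,R)\sim_d(132,R)$: (1) $R=\{(0,0),(0,2),(2,0),(2,2)\}$; (2) $R=\{(0,0),(0,2),(1,2),(2,0),(2,1),(2,3),(3,2)\}$; (3) $R=\{(0,0),(0,2),(1,1),(1,3),(2,0),(3,1),(3,3)\}$; (4) $R=\{(0,0),(0,2),(1,1),(1,3),(2,0),(2,2),(3,1),(3,3)\}$; (5) $R=\{(0,0),(0,2),(1,2),(2,0),(2,1),(2,2),(2,3),(3,2)\}$; (6) $R=\{(0,0),(0,2),(1,1),(1,2),(1,3),(2,0),(2,1),(2,3),(3,1),(3,2),(3,3)\}$; (7) $R=\{(0,0),(0,2),(1,1),(1,2),(1,3),(2,0),(2,1),(2,2),(2,3),(3,1),(3,2),(3,3)\}$.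
   Context: $S_n$ denotes the set of permutations of $[n]=\{1,\dots,n\}$, written $\pi=\pi_1\cdots\pi_n$. A mesh pattern of length $k$ is a pair $(\tau,R)$ with $\tau\in S_k$ and $R\subseteq\{0,1,\dots,k\}^2$ (the shaded boxes; box $(a,b)$ is the unit square $[a,a+1]\times[b,b+1]$ in the diagram of $\tau$). An occurrence of $(\tau,R)$ in $\pi\in S_n$ is a choice of indices $i_1<\dots<i_k$ such that $\pi_{i_1}\cdots\pi_{i_k}$ is order-isomorphic to $\tau$ and, with $i_0=0$, $i_{k+1}=n+1$, $v_1<\dots<v_k$ the values $\pi_{i_1},\dots,\pi_{i_k}$ sorted increasingly, $v_0=0$, $v_{k+1}=n+1$, for every $(a,b)\in R$ there is no index $m$ with $i_a<m<i_{a+1}$ and $v_b<\pi_m<v_{b+1}$. Mesh patterns $p,q$ are equidistributed, $p\sim_d q$, if for all $n,\ell\ge0$ the number of $\pi\in S_n$ with exactly $\ell$ occurrences of $p$ equals the number with exactly $\ell$ occurrences of $q$. *)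

(* Defs.v *)
From mathcomp Require Import all_boot all_fingroup.

Set Implicit Arguments.
Unset Strict Implicit.
Unset Printing Implicit Defensive.

(* Permutations and their indices are 0-based ('S_n acts on {0, ..., n-1}), so
   the i-th letter of pi in one-line notation on {1, ..., n} is
   (pi i).+1, where i : 'I_n stands for the position i.+1. *)

Record mesh_pattern (k : nat) := MeshPattern {
  underlying : 'S_k;
  shading : {set 'I_k.+1 * 'I_k.+1}
}.

(* For s = [:: s_1; ...; s_k], this is s_a with the conventions s_0 = 0 and
   s_(k+1) = n + 1. *)
Definition grid_line (n : nat) (s : seq nat) (a : nat) : nat :=
  nth 0 (0 :: rcons s n.+1) a.

Section Occurrences.

Variables (k n : nat) (p : mesh_pattern k) (pi : 'S_n).

Definition positions (f : {ffun 'I_k -> 'I_n}) : seq nat :=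
  [seq (f j).+1 | j <- enum 'I_k].

Definition sorted_values (f : {ffun 'I_k -> 'I_n}) : seq nat :=
  sort leq [seq (pi (f j)).+1 | j <- enum 'I_k].

Definition in_box (f : {ffun 'I_k -> 'I_n}) (a b : nat) (m : 'I_n) : bool :=
  (grid_line n (positions f) a < m.+1 < grid_line n (positions f) a.+1) &&
  (grid_line n (sorted_values f) b < (pi m).+1
     < grid_line n (sorted_values f) b.+1).

Definition occurrence (f : {ffun 'I_k -> 'I_n}) : bool :=
  [&& [forall i : 'I_k, forall j : 'I_k, (i < j) ==> (f i < f j)],
      [forall i : 'I_k, forall j : 'I_k,
         (pi (f i) < pi (f j)) == (underlying p i < underlying p j)]
    & [forall r in shading p, ~~ [exists m : 'I_n, in_box f r.1 r.2 m]]].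

Definition occurrences : nat := #|[set f | occurrence f]|.

End Occurrences.

Definition equidistributed (k k' : nat)
    (p : mesh_pattern k) (q : mesh_pattern k') : Prop :=
  forall n l : nat,
    #|[set pi : 'S_n | occurrences p pi == l]|
    = #|[set pi : 'S_n | occurrences q pi == l]|.

Notation "p ~d q" := (equidistributed p q) (at level 70, no associativity).

Definition boxes (k : nat) (s : seq (nat * nat)) : {set 'I_k.+1 * 'I_k.+1} :=
  [set r | (val r.1, val r.2) \in s].

Definition perm123 : 'S_3 := 1%g.
Definition perm132 : 'S_3 := tperm (@Ordinal 3 1 isT) (@Ordinal 3 2 isT).

Lemma perm123_one_line : [seq (perm123 i).+1 | i <- enum 'I_3] = [:: 1; 2; 3].
Proof.
by rewrite (eq_map (g := fun i : 'I_3 => i.+1)) => [|i]; rewrite ?perm1 //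
   (map_comp S val) val_enum_ord.
Qed.

Lemma perm132_one_line : [seq (perm132 i).+1 | i <- enum 'I_3] = [:: 1; 3; 2].
Proof.
by rewrite !enum_ordSl (size0nil (size_enum_ord 0)) /= /perm132 !permE.
Qed.

(* Main.v *)
(** Write [M] for the set of values of the left-to-right minima of [pi], and let
    [flip_gaps pi] reverse the values of [pi] inside every gap between
    consecutive elements of [M] (the last gap ends at [n]).  This is an
    involution which keeps the left-to-right minima in place.  In an occurrence
    of 123 or 132, box (0,0) makes the first letter a left-to-right minimum, and
    then box (0,2) puts the other two letters in the same gap, so that the
    involution exchanges 123 and 132 at the same three positions.  It preserves
    the set of letters below the first letter and the set of letters with values
    between those of the other two; it may only move letters between rows 1
    and 3.  Hence every shading which contains (0,0) and (0,2), and contains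
    (a,1) if and only if it contains (a,3), gives equidistributed patterns. *)

Require Import Defs.
From mathcomp Require Import all_boot all_fingroup.
From mathcomp Require Import zify.

Set Implicit Arguments.
Unset Strict Implicit.
Unset Printing Implicit Defensive.

(** * Reflection of the gaps between elements of a set of naturals *)

Section GapFlip.

Variables (M : pred nat) (n : nat).

Definition gap_floor (v : nat) : nat := \max_(i < v | M i) i.

(** A failing [find] returns the length of the list, here [n - v], so that the last gap ends at [n]
    with no separate case. *)
Definition gap_ceil (v : nat) : nat := v + find M (iota v (n - v)).

Definition gap_flip (v : nat) : nat :=
  if M v then v else gap_floor v + gap_ceil v - v.

Hypothesis M0 : M 0.

Lemma gap_ceilP v : v < n ->
  [/\ v <= gap_ceil v <= n, (gap_ceil v < n) ==> M (gap_ceil v)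
    & forall w, v <= w < gap_ceil v -> ~~ M w].
Proof.
move=> ltvn; have szE : size (iota v (n - v)) = n - v by rewrite size_iota.
have le_find := find_size M (iota v (n - v)); rewrite szE in le_find.
split; first by rewrite /gap_ceil; lia.
  apply/implyP => ltn; have has_M : has M (iota v (n - v)).
    by rewrite has_find szE; move: ltn; rewrite /gap_ceil; lia.
  have := nth_find 0 has_M; rewrite nth_iota //.
  by move: has_M; rewrite has_find szE.
move=> w; rewrite /gap_ceil => /andP[le_vw lt_w].
have := @before_find _ 0 M (iota v (n - v)) (w - v).
rewrite nth_iota ?subnKC //; last by lia.
by move->; rewrite //; lia.
Qed.

Lemma gap_floorP v : ~~ M v ->
  [/\ M (gap_floor v), gap_floor v < v
    & forall w, gap_floor v < w <= v -> ~~ M w].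
Proof.
case: v => [|v] notMv; first by rewrite M0 in notMv.
have le_floor w : w <= v -> M w -> w <= gap_floor v.+1.
  move=> lewv Mw.
  exact: (@leq_bigmax_cond _ (fun i : 'I_v.+1 => M i) (fun i => i : nat)
    (Ordinal (lewv : w < v.+1)) Mw).
(* The range of the maximum contains 0 by [M0], so the maximum is attained rather than a default. *)
have [i Mi floorE] : {i : 'I_v.+1 | M i & gap_floor v.+1 = i}.
  apply: (eq_bigmax_cond (A := [pred i : 'I_v.+1 | M i])).
  by apply/card_gt0P; exists ord0; rewrite inE.
rewrite floorE in le_floor *; split=> // w /andP[lt_iw].
rewrite leq_eqVlt => /predU1P[-> //|lt_wv]; apply/negP => Mw.
by have := le_floor w lt_wv Mw; lia.
Qed.

Lemma gap_flip_id v : M v -> gap_flip v = v.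
Proof. by rewrite /gap_flip => ->. Qed.

(** Floor and ceiling are constant on a gap, so one pair of endpoints serves every [w] in it. Later
    facts about [gap_flip] then reduce to linear arithmetic in [lo] and [hi]. *)
Lemma gapP v : v < n -> ~~ M v -> exists lo hi : nat,
  [/\ M lo, (hi < n) ==> M hi, lo < v < hi, hi <= n
    & forall w, lo < w < hi -> ~~ M w /\ gap_flip w = lo + hi - w].
Proof.
move=> ltvn notMv; exists (gap_floor v), (gap_ceil v).
have [Mlo ltlo loN] := gap_floorP notMv.
have [/andP[lehi hin] Mhi hiN] := gap_ceilP ltvn.
have notM w : gap_floor v < w < gap_ceil v -> ~~ M w.
  by move=> /andP[? ?]; case: (leqP w v) => ?; [apply: loN | apply: hiN]; lia.
have lthi : v < gap_ceil v.
  rewrite ltn_neqAle lehi andbT; apply/eqP => hiE; case: (ltnP (gap_ceil v) n).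
    by move=> h; move: Mhi; rewrite h -hiE (negbTE notMv).
  by rewrite -hiE; lia.
split; rewrite ?ltlo ?hin //.
move=> w wgap; have notMw := notM w wgap; split=> //.
have ltwn : w < n by lia.
have [Mlo' ltlo' loN'] := gap_floorP notMw.
have [/andP[lehi' hin'] Mhi' hiN'] := gap_ceilP ltwn.
rewrite /gap_flip (negbTE notMw).
(* Were the two floors different, the larger one would be an element of [M] in a range known to
   avoid [M]; the ceilings are compared in the same way. *)
have -> : gap_floor w = gap_floor v.
  case: (ltngtP (gap_floor w) (gap_floor v)) => // h.
    by have := loN' (gap_floor v); rewrite Mlo; lia.
  by have := notM (gap_floor w); rewrite Mlo'; lia.
suff -> : gap_ceil w = gap_ceil v by [].
case: (ltngtP (gap_ceil w) (gap_ceil v)) => // h.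
  have ltn' : gap_ceil w < n by lia.
  by have := notM (gap_ceil w); rewrite (implyP Mhi' ltn'); lia.
have ltn' : gap_ceil v < n by lia.
by have := hiN' (gap_ceil v); rewrite (implyP Mhi ltn'); lia.
Qed.

Lemma gap_flip_lt v : v < n -> gap_flip v < n.
Proof.
move=> ltvn; case: (boolP (M v)) => [/gap_flip_id -> //|].
by case/(gapP ltvn) => lo [hi [_ _ ? ? /(_ v) []]] // _ ->; lia.
Qed.

Lemma gap_flipK v : v < n -> gap_flip (gap_flip v) = v.
Proof.
move=> ltvn; case: (boolP (M v)) => [Mv|]; first by rewrite !gap_flip_id.
case/(gapP ltvn) => lo [hi [_ _ vgap _ E]].
by have [_ ->] := E v vgap; have [|_ ->] := E (lo + hi - v); lia.
Qed.

(** An element of [M] is never inside a gap, so a value and its mirror image lie on the same side of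
    it. *)
Lemma ltn_gap_flip m v : M m -> v < n -> (m < gap_flip v) = (m < v).
Proof.
move=> Mm ltvn; case: (boolP (M v)) => [/gap_flip_id -> //|notMv].
case/(gapP ltvn): (notMv) => lo [hi [_ _ vgap _ E]].
have [_ ->] := E v vgap.
have mout : ~~ (lo < m < hi) by apply/negP => /E[]; rewrite Mm.
by lia.
Qed.

(** The absence of [M] on [[u, v]] expresses that [u] and [v] share a gap. The second conclusion
    says the same of their images, so that the lemma can be applied again to these. *)
Lemma gap_flip_anti u v : u < v < n ->
  (forall w, u <= w <= v -> ~~ M w) ->
  gap_flip v < gap_flip u /\
  forall w, gap_flip v <= w <= gap_flip u -> ~~ M w.
Proof.
move=> /andP[ltuv ltvn] same; have ltun : u < n by lia.
have notMu : ~~ M u by apply: same; lia.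
case/(gapP ltun): notMu => lo [hi [Mlo Mhi ugap lehi E]].
have vgap : lo < v < hi.
  apply/andP; split; first lia.
  rewrite ltnNge; apply/negP => lehv.
  have lthi : hi < n by lia.
  by have := same hi; rewrite (implyP Mhi lthi); lia.
have [_ ->] := E v vgap; have [_ ->] := E u ugap.
by split=> [|w wb]; [lia | have [|] := E w; lia].
Qed.

Lemma gap_flip_between u v w : u < v < n -> w < n ->
  (forall x, u <= x <= v -> ~~ M x) ->
  (gap_flip v < gap_flip w < gap_flip u) = (u < w < v).
Proof.
have fwd u' v' w' : u' < v' < n -> (forall x, u' <= x <= v' -> ~~ M x) ->
    u' < w' < v' -> gap_flip v' < gap_flip w' < gap_flip u'.
  move=> uv same uwv.
  have [|x xb|-> _] := @gap_flip_anti u' w'; [lia|by apply: same; lia|].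
  by have [|x xb|-> _] := @gap_flip_anti w' v'; [lia|by apply: same; lia|].
(* The remaining direction is [fwd] applied to the images, since [gap_flip] is an involution. *)
move=> uv ltwn same; apply/idP/idP; last exact: fwd.
have ltun : u < n by lia. have ltvn : v < n by lia.
have [lt' same'] := gap_flip_anti uv same.
have lt'n := gap_flip_lt ltun.
move=> /fwd; rewrite !gap_flipK //; apply=> //; lia.
Qed.

End GapFlip.

Lemma eq_gap_flip (M M' : pred nat) n v :
  M =1 M' -> gap_flip M n v = gap_flip M' n v.
Proof.
move=> eqM; rewrite /gap_flip /gap_floor /gap_ceil eqM (eq_find eqM).
by rewrite (eq_bigl (fun i : 'I_v => M' i)).
Qed.

(** * The involution on permutations given by the left-to-right minima *)

Section LRMinima.

Variable n : nat.
Implicit Types (pi : 'S_n) (i j : 'I_n).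

Definition is_lrmin pi i : bool := [forall j : 'I_n, (j < i) ==> (pi i < pi j)].

Definition lrmin_value pi (v : nat) : bool :=
  [exists i : 'I_n, (pi i == v :> nat) && is_lrmin pi i].

Lemma lrmin_valueE pi i : lrmin_value pi (pi i) = is_lrmin pi i.
Proof.
apply/existsP/idP => [[j /andP[/eqP/val_inj/perm_inj -> //]]|min_i].
by exists i; rewrite eqxx.
Qed.

(** The least letter among those at positions up to [i] is a left-to-right minimum. *)
Lemma exists_lrmin pi i :
  exists2 j : 'I_n, j <= i & is_lrmin pi j && (pi j <= pi i).
Proof.
case: (arg_minnP (P := [pred j : 'I_n | j <= i]) (fun j : 'I_n => pi j : nat) (leqnn i))
  => j /= le_ji min_j.
exists j => //; rewrite min_j // andbT; apply/forallP => k; apply/implyP => lt_kj.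
rewrite ltn_neqAle min_j /=; last by lia.
by rewrite andbT; apply/eqP => /val_inj/perm_inj jk; rewrite jk ltnn in lt_kj.
Qed.

(** The index [i] serves as a witness that [n] is positive, so that the value 0 occurs. *)
Lemma lrmin_value0 pi i : lrmin_value pi 0.
Proof.
have lt0n : 0 < n by case: i => i /=; lia.
have [j _ /andP[min_j]] := exists_lrmin pi ((pi^-1)%g (Ordinal lt0n)).
rewrite permKV /= leqn0 => /eqP pij0.
by rewrite -pij0 lrmin_valueE.
Qed.

Definition flip_value pi (v : 'I_n) : 'I_n :=
  insubd v (gap_flip (lrmin_value pi) n v).

Lemma flip_valueE pi v : flip_value pi v = gap_flip (lrmin_value pi) n v :> nat.
Proof. by rewrite val_insubd gap_flip_lt //; apply: lrmin_value0 v. Qed.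

Lemma flip_valueK pi : involutive (flip_value pi).
Proof.
move=> v; apply: val_inj; rewrite /= !flip_valueE gap_flipK //.
exact: lrmin_value0 v.
Qed.

(** Products of permutations apply the left factor first, so the reflection acts on values and
    positions stay fixed. *)
Definition flip_gaps pi : 'S_n := (pi * perm (inv_inj (flip_valueK pi)))%g.

Lemma flip_gapsE pi i :
  flip_gaps pi i = gap_flip (lrmin_value pi) n (pi i) :> nat.
Proof. by rewrite permM permE flip_valueE. Qed.

Lemma is_lrmin_flip pi i : is_lrmin (flip_gaps pi) i = is_lrmin pi i.
Proof.
have M0 := lrmin_value0 pi i.
apply/idP/idP => [/forallP min_i|min_i]; last first.
  have Mi : lrmin_value pi (pi i) by rewrite lrmin_valueE.
  apply/forallP => j; apply/implyP => lt_ji; rewrite !flip_gapsE.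
  rewrite (gap_flip_id _ Mi) ltn_gap_flip //.
  by move/forallP: min_i => /(_ j); rewrite lt_ji.
(* If [i] is not a left-to-right minimum of [pi], some minimum [j] before it is smaller. Its value
   is fixed and stays below the image of [pi i], a contradiction. *)
have [j le_ji /andP[min_j le_pi]] := exists_lrmin pi i.
case: (ltngtP j i) le_ji => // [lt_ji _|/val_inj <- //].
have Mj : lrmin_value pi (pi j) by rewrite lrmin_valueE.
have := min_i j; rewrite lt_ji /= !flip_gapsE (gap_flip_id _ Mj).
rewrite ltnNge => /negP[]; rewrite ltnW // ltn_gap_flip //.
rewrite ltn_neqAle le_pi andbT; apply/eqP => /val_inj/perm_inj ji.
by rewrite ji ltnn in lt_ji.
Qed.

(** Hence a second application of [flip_gaps] reflects the same gaps and undoes the first. *)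
Lemma lrmin_value_flip pi : lrmin_value (flip_gaps pi) =1 lrmin_value pi.
Proof.
move=> v; apply: eq_existsb => i; rewrite is_lrmin_flip.
case: (boolP (is_lrmin pi i)) => min_i; rewrite ?andbF // !andbT.
by rewrite flip_gapsE gap_flip_id // lrmin_valueE.
Qed.

Lemma flip_gapsK : involutive flip_gaps.
Proof.
move=> pi; apply/permP => i; apply: val_inj; rewrite /= !flip_gapsE.
rewrite -[RHS](gap_flipK (lrmin_value0 pi i) (ltn_ord (pi i))).
by rewrite (eq_gap_flip _ _ (lrmin_value_flip pi)).
Qed.

End LRMinima.

(** * Occurrences of 123 and 132 and the effect of the involution on them *)

Definition o0 : 'I_3 := @Ordinal 3 0 isT.
Definition o1 : 'I_3 := @Ordinal 3 1 isT.
Definition o2 : 'I_3 := @Ordinal 3 2 isT.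

Lemma enum_I3 : enum 'I_3 = [:: o0; o1; o2].
Proof. by apply: (inj_map val_inj); rewrite val_enum_ord. Qed.

Lemma forall_I3 (P : pred 'I_3) : [forall i, P i] = [&& P o0, P o1 & P o2].
Proof.
apply/forallP/and3P => [P_ | [P0 P1 P2]]; first by split; apply: P_.
by case=> [[|[|[|//]]] lti]; rewrite ?(bool_irrelevance lti isT).
Qed.

(** A boolean parameter treats both patterns at once; exchanging them is negation. *)
Definition perm1xx (up : bool) : 'S_3 := if up then perm123 else perm132.

Lemma perm1xxE up : [/\ perm1xx up o0 = o0,
  perm1xx up o1 = (if up then o1 else o2) & perm1xx up o2 = (if up then o2 else o1)].
Proof.
case: up; rewrite /perm1xx; first by rewrite !perm1.
by split; apply: val_inj; rewrite /perm132 permE.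
Qed.

(** With [minn] and [maxn] in place of sorting, the horizontal grid lines have the same form for
    both patterns. *)
Definition box3_empty n (pi : 'S_n) (x1 x2 x3 : 'I_n) (a b : nat) : Prop :=
  let X := grid_line n [:: x1.+1; x2.+1; x3.+1] in
  let Y := grid_line n [:: (pi x1).+1; (minn (pi x2) (pi x3)).+1;
                           (maxn (pi x2) (pi x3)).+1] in
  forall m : 'I_n, X a < m.+1 < X a.+1 -> ~~ (Y b < (pi m).+1 < Y b.+1).

Definition occurrence3 (s : seq (nat * nat)) (up : bool) n (pi : 'S_n)
    (x1 x2 x3 : 'I_n) : Prop :=
  [/\ x1 < x2 < x3, pi x1 < pi x2 /\ pi x1 < pi x3, (pi x2 < pi x3) = up
    & forall a b : 'I_4, (val a, val b) \in s -> box3_empty pi x1 x2 x3 a b].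

Lemma occurrence3P s up n (pi : 'S_n) (f : {ffun 'I_3 -> 'I_n}) :
  reflect (occurrence3 s up pi (f o0) (f o1) (f o2))
          (occurrence (MeshPattern (perm1xx up) (boxes 3 s)) pi f).
Proof.
have [p0 p1 p2] := perm1xxE up.
have incE : [forall i : 'I_3, forall j : 'I_3, (i < j) ==> (f i < f j)]
    = (f o0 < f o1 < f o2).
  by rewrite forall_I3 !forall_I3 /=; apply/idP/idP; lia.
have neq23 : f o0 < f o1 < f o2 -> pi (f o1) != pi (f o2) :> nat.
  move=> lt; apply/eqP => /val_inj/perm_inj eq12; rewrite eq12 in lt; lia.
have ordE : f o0 < f o1 < f o2 ->
  [forall i : 'I_3, forall j : 'I_3,
     (pi (f i) < pi (f j)) == (perm1xx up i < perm1xx up j)]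
  = [&& pi (f o0) < pi (f o1), pi (f o0) < pi (f o2)
      & (pi (f o1) < pi (f o2)) == up].
  move/neq23; rewrite forall_I3 !forall_I3 p0 p1 p2.
  by case: up {p0 p1 p2} => /= ?; apply/idP/idP; lia.
have sortE : pi (f o0) < pi (f o1) -> pi (f o0) < pi (f o2) ->
  sorted_values pi f = [:: (pi (f o0)).+1; (minn (pi (f o1)) (pi (f o2))).+1;
                           (maxn (pi (f o1)) (pi (f o2))).+1].
  move=> lt1 lt2; rewrite /sorted_values enum_I3 /=.
  apply: (sorted_eq leq_trans anti_leq); first exact/sort_sorted/leq_total.
    by rewrite /= andbT; lia.
  rewrite perm_sort perm_cons minnE maxnE.
  case: (leqP (pi (f o1)) (pi (f o2))) => h.
    by have -> : pi (f o1) - (pi (f o1) - pi (f o2)) = pi (f o1); [lia|];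
       have -> : pi (f o1) + (pi (f o2) - pi (f o1)) = pi (f o2); [lia|].
  have -> : pi (f o1) - (pi (f o1) - pi (f o2)) = pi (f o2) by lia.
  have -> : pi (f o1) + (pi (f o2) - pi (f o1)) = pi (f o1) by lia.
  by rewrite (perm_catC [:: _] [:: _]).
rewrite /occurrence incE; apply: (iffP and3P).
  move=> [inc]; rewrite /= ordE // => /and3P[lt1 lt2 /eqP ltE] /forall_inP emp.
  split=> // a b ab_s; have /emp : (a, b) \in boxes 3 s by rewrite inE.
  rewrite negb_exists => /forallP empab X Y m; move: (empab m).
  by rewrite /in_box sortE // /positions enum_I3 negb_and => /orP[/negP|].
move=> [inc [lt1 lt2] ltE emp]; split=> //=; first by rewrite ordE // lt1 lt2 ltE /=.
apply/forall_inP => -[a b]; rewrite inE => /emp empab.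
rewrite negb_exists; apply/forallP => m.
rewrite /in_box sortE // /positions enum_I3 negb_and.
by rewrite -implybE; apply/implyP => /empab.
Qed.

Lemma occurrence3_flip (s : seq (nat * nat)) up n (pi : 'S_n) x1 x2 x3 :
  (0, 0) \in s -> (0, 2) \in s ->
  (forall a : 'I_4, ((val a, 1) \in s) = ((val a, 3) \in s)) ->
  occurrence3 s up pi x1 x2 x3 ->
  occurrence3 s (~~ up) (flip_gaps pi) x1 x2 x3.
Proof.
move=> s00 s02 s13 [inc [lt1 lt2] ltE emp].
set M := lrmin_value pi; have M0 : M 0 := lrmin_value0 pi x1.
(* Box (0,0) holds no letter before and below [x1]. *)
have min1 : is_lrmin pi x1.
  apply/forallP => j; apply/implyP => lt_j1.
  have := emp ord0 ord0 s00 j; rewrite /grid_line /= => /(_ _).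
  have : pi j != pi x1 :> nat.
    by apply/eqP => /val_inj/perm_inj j1; rewrite j1 ltnn in lt_j1.
  by move=> ? /(_ _); lia.
have M1 : M (pi x1) by rewrite /M lrmin_valueE.
have neq23 : pi x2 != pi x3 :> nat.
  by apply/eqP => /val_inj/perm_inj eq23; rewrite eq23 in inc; lia.
have notM (x : 'I_n) : x1 < x -> pi x1 < pi x -> ~~ M (pi x).
  move=> ltx ltpi; rewrite /M lrmin_valueE negb_forall.
  by apply/existsP; exists x1; rewrite ltx /=; lia.
have [notM2 notM3] : ~~ M (pi x2) /\ ~~ M (pi x3) by split; apply: notM; lia.
set lo := minn (pi x2) (pi x3); set hi := maxn (pi x2) (pi x3).
(* A left-to-right minimum strictly between the two upper values would lie in box (0,2) if it came
   before [x1], and would exceed the earlier letter at [x1] if it came after. *)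
have same w : lo <= w <= hi -> ~~ M w.
  move=> wb; apply/negP => /[dup] Mw /existsP[j /andP[/eqP jw min_j]].
  have wneq : w != pi x2 /\ w != pi x3.
    by split; apply/eqP => wE; move: Mw; rewrite wE; apply/negP.
  case: (ltngtP j x1) => [ltj|ltj|/val_inj jE].
  - have := emp ord0 (@Ordinal 4 2 isT) s02 j; rewrite /grid_line /= -/lo -/hi jw.
    by clear - ltj wb wneq jw; move=> /(_ _); lia.
  - move/forallP: min_j => /(_ x1); rewrite ltj /=.
    by clear - wb jw lt1 lt2; lia.
  - by rewrite jE in jw; clear - wb jw lt1 lt2; lia.
have lohi : lo < hi < n.
  by have := ltn_ord (pi x2); have := ltn_ord (pi x3); lia.
have [lt' _] := gap_flip_anti M0 lohi same.
have [minE maxE] :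
  minn (flip_gaps pi x2) (flip_gaps pi x3) = gap_flip M n hi /\
  maxn (flip_gaps pi x2) (flip_gaps pi x3) = gap_flip M n lo.
  rewrite !flip_gapsE -/M; move: lt'; rewrite /lo /hi.
  by clear - neq23; case: (ltngtP (pi x2) (pi x3)) neq23 => // h _; lia.
have flip1 : flip_gaps pi x1 = pi x1 :> nat by rewrite flip_gapsE gap_flip_id.
split=> //.
- by rewrite flip1 !flip_gapsE !ltn_gap_flip.
- rewrite -ltE !flip_gapsE -/M; move: lt'; rewrite /lo /hi.
  by clear - neq23; case: (ltngtP (pi x2) (pi x3)) neq23 => // h _; lia.
have /andP[lt_lohi lt_hin] := lohi.
have lt1' : pi x1 < gap_flip M n hi.
  by rewrite ltn_gap_flip // /hi leq_max lt1.
move=> a b ab_s X Y m mX; rewrite /Y {Y}.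
have ltpim := ltn_ord (pi m).
have below : (pi x1 < gap_flip M n (pi m)) = (pi x1 < pi m) by apply: ltn_gap_flip.
have eqflip v : v < n -> (gap_flip M n (pi m) == gap_flip M n v) = (pi m == v :> nat).
  move=> ltv; apply/eqP/eqP => [E|->//].
  by rewrite -(gap_flipK M0 ltpim) E gap_flipK.
have btw := gap_flip_between M0 lohi ltpim same.
have eqlo := eqflip lo (ltn_trans lt_lohi lt_hin).
have eqhi := eqflip hi lt_hin.
have eqx1 : (gap_flip M n (pi m) == pi x1) = (pi m == pi x1 :> nat).
  by rewrite -{1}(gap_flip_id n M1) eqflip.
rewrite minE maxE flip1 flip_gapsE -/M.
move: (emp a); rewrite /box3_empty -/lo -/hi => empa.
clearbody lo hi.
(* Columns are unchanged, so only the row of [m] matters. Rows 0 and 2 come from themselves; a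
   letter now in row 1 or 3 was in row 1 or 3 before, and [s13] makes both boxes of that column
   shaded. *)
case: b ab_s => [[|[|[|[|//]]]] ltb] /= ab_s; apply/negP; rewrite /grid_line /= => mY.
- have := empa ord0 ab_s m mX; rewrite /grid_line /=.
  by clear - mY below eqx1; lia.
- have := empa (@Ordinal 4 1 isT) ab_s m mX.
  have := empa (@Ordinal 4 3 isT) (etrans (esym (s13 a)) ab_s) m mX.
  by rewrite /grid_line /=; clear - mY below btw eqlo eqhi lt' lt1' ltpim; lia.
- have := empa (@Ordinal 4 2 isT) ab_s m mX; rewrite /grid_line /=.
  by clear - mY btw; lia.
- have := empa (@Ordinal 4 1 isT) (etrans (s13 a) ab_s) m mX.
  have := empa (@Ordinal 4 3 isT) ab_s m mX.
  by rewrite /grid_line /=; clear - mY below btw eqlo eqhi lt' lt1' ltpim; lia.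
Qed.

(** All three hypotheses are decided by computation on a concrete list [s]. *)
Lemma equidistributed_123_132 (s : seq (nat * nat)) :
  (0, 0) \in s -> (0, 2) \in s ->
  all (fun a => ((a, 1) \in s) == ((a, 3) \in s)) (iota 0 4) ->
  MeshPattern perm123 (boxes 3 s) ~d MeshPattern perm132 (boxes 3 s).
Proof.
move=> s00 s02 /allP s13 n l.
have {}s13 (a : 'I_4) : ((val a, 1) \in s) = ((val a, 3) \in s).
  by apply/eqP/s13; rewrite mem_iota /=.
(* The right-hand set is replaced by its preimage under [flip_gaps]. It then suffices that the same
   [f] are occurrences of 123 in [pi] and of 132 in [flip_gaps pi]. *)
rewrite -[RHS](card_preimset _ (inv_inj (@flip_gapsK n))).
congr #|pred_of_set _|; apply/setP => pi; rewrite !inE; congr (_ == _).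
apply: eq_card => f; rewrite !inE.
apply/(occurrence3P s true)/(occurrence3P s false) => occ.
  exact: (occurrence3_flip s00 s02 s13 occ).
by rewrite -[pi]flip_gapsK; apply: (occurrence3_flip s00 s02 s13 occ).
Qed.

Theorem theorem3p6 :
  (let R := boxes 3 [:: (0, 0); (0, 2); (2, 0); (2, 2)] in
   MeshPattern perm123 R ~d MeshPattern perm132 R) /\
  (let R := boxes 3 [:: (0, 0); (0, 2); (1, 2); (2, 0); (2, 1); (2, 3); (3, 2)] in
   MeshPattern perm123 R ~d MeshPattern perm132 R) /\
  (let R := boxes 3 [:: (0, 0); (0, 2); (1, 1); (1, 3); (2, 0); (3, 1); (3, 3)] in
   MeshPattern perm123 R ~d MeshPattern perm132 R) /\
  (let R := boxes 3 [:: (0, 0); (0, 2); (1, 1); (1, 3); (2, 0); (2, 2); (3, 1); (3, 3)] in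
   MeshPattern perm123 R ~d MeshPattern perm132 R) /\
  (let R := boxes 3 [:: (0, 0); (0, 2); (1, 2); (2, 0); (2, 1); (2, 2); (2, 3); (3, 2)] in
   MeshPattern perm123 R ~d MeshPattern perm132 R) /\
  (let R := boxes 3 [:: (0, 0); (0, 2); (1, 1); (1, 2); (1, 3); (2, 0); (2, 1); (2, 3); (3, 1); (3, 2); (3, 3)] in
   MeshPattern perm123 R ~d MeshPattern perm132 R) /\
  (let R := boxes 3 [:: (0, 0); (0, 2); (1, 1); (1, 2); (1, 3); (2, 0); (2, 1); (2, 2); (2, 3); (3, 1); (3, 2); (3, 3)] in
   MeshPattern perm123 R ~d MeshPattern perm132 R).
Proof.
by do 6?split; apply: equidistributed_123_132.
Qed.
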